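(* Consider the nonlinear forward-backward stochastic difference equation $$ \left\{ \begin{array}{rcl} \Delta X_t&=&b(t,X_t,Y_t,Z_t\widetilde I)+\sigma(t,X_t,Y_t,Z_t\widetilde I)M_{t+1},\\ \Delta Y_t&=&-f(t+1,X_{t+1},Y_{t+1},Z_{t+1}\widetilde I)+Z_tM_{t+1},\\ X_0&=&x_0,\\ Y_T&=&h(X_T), \end{array}\right.\qquad t\in\{0,\dots,T-1\}. $$ For $\lambda=(x,y,z)\in\mathbb R\times\mathbb R\times\mathbb R^{1\times N}$ write $b(t,\lambda)=b(t,x,y,z\widetilde I)$, and similarly for $\sigma,f$; put $|\lambda|=|x|+|y|+|z\widetilde I|$ and $$A(t,\lambda)=\left(-f(t,\lambda),\,b(t,\lambda),\,\sigma(t,\lambda)\mathbb E[M_{t+1}M_{t+1}^{*}|\mathcal F_t]\right),$$ $$|A(t,\lambda)|=|f(t,\lambda)|+|b(t,\lambda)|+\left|\sigma(t,\lambda)\mathbb E[M_{t+1}M_{t+1}^{*}|\mathcal F_t]\right|.$$ Suppose there are constants $c_1,c_2>0$ such that for all $\lambda=(x,y,z)$, $\lambda'=(x',y',z')$ (and all $\omega$): (i) (Lipschitz condition) for $t\in\{0,\dots,T-1\}$, $|A(t,\lambda)-A(t,\lambda')|\le c_1|\lambda-\lambda'|$ (with the $f$-component omitted when $t=0$); $|h(x)-h(x')|\le c_1|x-x'|$; and $|f(T,x,y,z\widetilde I)-f(T,x',y',z'\widetilde I)|\le c_1(|x-x'|+|y-y'|)$; (ii) (monotone condition) - for $t\in\{1,\dots,T-1\}$,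 $\langle A(t,\lambda)-A(t,\lambda'),\lambda-\lambda'\rangle\le -c_2|\lambda-\lambda'|^2$; - for $t=T$, $\langle -f(T,x,y,z\widetilde I)+f(T,x',y',z'\widetilde I),x-x'\rangle\le -c_2|x-x'|^2$; - for $t=0$, $\langle b(0,\lambda)-b(0,\lambda'),y-y'\rangle+\langle(\sigma(0,\lambda)-\sigma(0,\lambda'))\mathbb E[M_1M_1^{*}|\mathcal F_0],z-z'\rangle\le -c_2\left[|y-y'|^2+|(z-z')\widetilde I|^2\right]$; - $\langle h(x)-h(x'),x-x'\rangle\ge c_2|x-x'|^2$. Then the equation has a unique adapted solution $(X,Y,Z)\in\mathcal M(0,T;\mathbb R)\times\mathcal M(0,T;\mathbb R)\times\mathcal M(0,T-1;\mathbb R^{1\times N})$, where uniqueness of $X$ and $Y$ is in the sense of indistinguishability and uniqueness of $Z$ is up to the equivalence $\sim_M$.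
   Context: Setting. $T>0$ is a deterministic integer time horizon and $W=(W_t)_{t=0}^T$ is a process with values in the standard basis vectors $\{e_1,\dots,e_N\}$ of $\mathbb R^N$ (column vectors). $[\cdot]^{*}$ denotes transposition. $(\Omega,\mathcal F,\{\mathcal F_t\}_{0\le t\le T},P)$ is a filtered probability space, $\mathcal F_t$ being the completion of the $\sigma$-algebra generated by $W$ up to time $t$, and $\mathcal F=\mathcal F_T$. Standing assumption: for all $t\in\{0,\dots,T-1\}$ and $\omega\in\Omega$, $\mathbb E[W_{t+1}|\mathcal F_t](\omega)>0$ componentwise; accordingly ''almost surely'' is read as ''for every $\omega$''. $M_t=W_t-\mathbb E[W_t|\mathcal F_{t-1}]$, $t=1,\dots,T$. $\Delta U_t=U_{t+1}-U_t$. $\widetilde I$ is the $N\times(N-1)$ matrix $\begin{pmatrix}I_{(N-1)\times(N-1)}&-\mathbf 1_{N-1}\end{pmatrix}^{*}$, with $\mathbf 1_{N-1}$ the all-ones column vector. $\mathcal M(s,t;E)$ is the set of adapted $E$-valued processes indexed by $\{s,\dots,t\}$. $Z\sim_M\widetilde Z$ means $Z_tM_{t+1}=\widetilde Z_tM_{t+1}$ for all $t\in\{0,\dots,T-1\}$. Coefficients. $x_0\in\mathbb R$; $b:\Omega\times\{0,\dots,T-1\}\times\mathbb R\times\mathbb R\times\mathbb R^{1\times(N-1)}\to\mathbb R$, $\sigma:\Omega\times\{0,\dots,T-1\}\times\mathbb R\times\mathbb R\times\mathbb R^{1\times(N-1)}\to\mathbb R^{1\times N}$, $f:\Omega\times\{1,\dots,T\}\times\mathbb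 R\times\mathbb R\times\mathbb R^{1\times(N-1)}\to\mathbb R$ and $h:\Omega\times\mathbb R\to\mathbb R$ are adapted mappings (the time-$t$ value is $\mathcal F_t$-measurable for fixed other arguments; $h$ is $\mathcal F_T$-measurable) and continuous in the non-$\omega$, non-time arguments. By the Lipschitz condition at $T$, $f(T,\cdot)$ does not depend on its last argument, so $Z_T$ does not enter. $\langle\cdot,\cdot\rangle$ is the Euclidean inner product on $\mathbb R\times\mathbb R\times\mathbb R^{1\times N}$ (respectively on $\mathbb R$ and $\mathbb R^{1\times N}$). *)

(* Defs.v *)
From HB Require Import structures.
From mathcomp Require Import all_boot all_order all_algebra.
From mathcomp Require Import all_classical all_reals all_analysis.

Set Implicit Arguments.
Unset Strict Implicit.
Unset Printing Implicit Defensive.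

Import Order.TTheory GRing.Theory Num.Theory.
Import numFieldNormedType.Exports.

Local Open Scope classical_set_scope.
Local Open Scope ring_scope.

(* Throughout, N = n.+1, so that N - 1 = n. Processes are functions
   nat -> Omega -> E; only the times within the horizon are ever constrained,
   the values at other times are irrelevant. *)

Section linear_algebra.
Context {R : realType}.

(* The library norm on matrices is the sup norm, hence these. *)
Definition dotr {m : nat} (u v : 'rV[R]_m) : R := (u *m v^T) ord0 ord0.
Definition enorm {m : nat} (u : 'rV[R]_m) : R := Num.sqrt (dotr u u).

(* The transpose of the block matrix (I_n | -1_n): the first n rows form the
   identity matrix and the entries of the last row are all -1. *)
Definition Itilde {n : nat} : 'M[R]_(n.+1, n) :=
  \matrix_(i, j) if i == ord_max then -1 else (i == j :> nat)%:R.

(* |(a, b, v)| and the inner product on R x R x R^(1 x N). *)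
Definition norm3 {m : nat} (a : R * R * 'rV[R]_m) : R :=
  `|a.1.1| + `|a.1.2| + enorm a.2.
Definition dot3 {m : nat} (a b : R * R * 'rV[R]_m) : R :=
  a.1.1 * b.1.1 + a.1.2 * b.1.2 + dotr a.2 b.2.

(* |lambda| = |x| + |y| + |z Itilde|, only a seminorm in z. *)
Definition normL {n : nat} (l : R * R * 'rV[R]_n.+1) : R :=
  `|l.1.1| + `|l.1.2| + enorm (l.2 *m Itilde).

End linear_algebra.

Section probability.
Context {d : measure_display} {Omega : measurableType d} {R : realType}.
Variable P : probability Omega R.

(* Measurability of a real (resp. matrix-valued) function with respect to a
   sigma-algebra G on Omega. *)
Definition measurable_wrt (G : set (set Omega)) (g : Omega -> R) : Prop :=
  preimage_set_system setT g measurable `<=` G.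

Definition mx_measurable_wrt {m p : nat} (G : set (set Omega))
    (g : Omega -> 'M[R]_(m, p)) : Prop :=
  forall i j, measurable_wrt G (fun w => g w i j).

(* The P-completion of G: the sets that differ from an element of G by a
   subset of a P-null element of G. *)
Definition completion (G : set (set Omega)) : set (set Omega) :=
  [set A | exists B C, [/\ G B, G C, P C = 0%E & A `+` B `<=` C]].

Definition generated_by {m : nat} (W : nat -> Omega -> 'cV[R]_m) (t : nat) :
    set (set Omega) :=
  <<s \bigcup_(s in [set s | (s <= t)%N]) \bigcup_(i in [set: 'I_m])
        preimage_set_system setT (fun w => W s w i ord0) measurable >>.

Definition filtration {m : nat} (W : nat -> Omega -> 'cV[R]_m) (t : nat) :
  set (set Omega) := completion (generated_by W t).

(* V is a version of the conditional expectation E[X | G]. *)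
Definition is_cond_exp (G : set (set Omega)) (X V : Omega -> R) : Prop :=
  [/\ measurable_wrt G V,
      P.-integrable setT (EFin \o V) &
      forall A, G A ->
        (\int[P]_(w in A) (V w)%:E = \int[P]_(w in A) (X w)%:E)%E].

Definition is_cond_exp_mx {m p : nat} (G : set (set Omega))
    (X V : Omega -> 'M[R]_(m, p)) : Prop :=
  forall i j, is_cond_exp G (fun w => X w i j) (fun w => V w i j).

Definition basis_valued {m : nat} (T : nat) (W : nat -> Omega -> 'cV[R]_m) :=
  forall t w, (t <= T)%N -> exists i, W t w = delta_mx i ord0.

(* E[W_(t+1) | F_t](w) > 0 for every w. A conditional expectation is only
   determined up to null sets, and the pointwise requirement is meant for
   every version: no change of version on a null event can destroy it, so a
   nonempty event of F_T has positive probability and "almost surely" is the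
   same as "for every w". *)
Definition positive_transitions {m : nat} (T : nat)
    (W : nat -> Omega -> 'cV[R]_m) : Prop :=
  forall t V, (t < T)%N -> is_cond_exp_mx (filtration W t) (W t.+1) V ->
    forall w i, 0 < V w i ord0.

(* M_t = W_t - E[W_t | F_(t-1)] for t = 1, ..., T. *)
Definition is_mart_diff {m : nat} (T : nat)
    (W M : nat -> Omega -> 'cV[R]_m) : Prop :=
  forall t, (t < T)%N ->
    exists2 V, is_cond_exp_mx (filtration W t) (W t.+1) V &
      forall w, M t.+1 w = W t.+1 w - V w.

(* Q_t = E[M_(t+1) M_(t+1)^* | F_t] for t = 0, ..., T - 1. *)
Definition is_cond_cov {m : nat} (T : nat)
    (W M : nat -> Omega -> 'cV[R]_m) (Q : nat -> Omega -> 'M[R]_m) : Prop :=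
  forall t, (t < T)%N ->
    is_cond_exp_mx (filtration W t)
      (fun w => M t.+1 w *m (M t.+1 w)^T) (Q t).

(* M(0, t; R) and M(0, t; R^(1 x m)). *)
Definition adapted {m : nat} (W : nat -> Omega -> 'cV[R]_m) (t : nat)
    (U : nat -> Omega -> R) : Prop :=
  forall s, (s <= t)%N -> measurable_wrt (filtration W s) (U s).

Definition adapted_mx {m p q : nat} (W : nat -> Omega -> 'cV[R]_m) (t : nat)
    (U : nat -> Omega -> 'M[R]_(p, q)) : Prop :=
  forall s, (s <= t)%N -> mx_measurable_wrt (filtration W s) (U s).

End probability.

Section equation.
Context {d : measure_display} {Omega : measurableType d} {R : realType}.
Context {n : nat}.
Variables (P : probability Omega R) (T : nat).
Variables (W M : nat -> Omega -> 'cV[R]_n.+1) (Q : nat -> Omega -> 'M[R]_n.+1).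
Variables (x0 : R).
Variables (b f : Omega -> nat -> R -> R -> 'rV[R]_n -> R).
Variables (sigma : Omega -> nat -> R -> R -> 'rV[R]_n -> 'rV[R]_n.+1).
Variables (h : Omega -> R -> R).

Local Notation Lambda := (R * R * 'rV[R]_n.+1)%type.
Local Notation F := (filtration P W).

Definition adapted_coefficients : Prop :=
  [/\ forall t x y z, (t < T)%N ->
        measurable_wrt (F t) (fun w => b w t x y z),
      forall t x y z, (t < T)%N ->
        mx_measurable_wrt (F t) (fun w => sigma w t x y z),
      forall t x y z, (0 < t <= T)%N ->
        measurable_wrt (F t) (fun w => f w t x y z) &
      forall x, measurable_wrt (F T) (fun w => h w x)].

Definition continuous_coefficients : Prop :=
  [/\ forall w t, (t < T)%N ->
        continuous (fun a : R * R * 'rV[R]_n => b w t a.1.1 a.1.2 a.2),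
      forall w t, (t < T)%N ->
        continuous (fun a : R * R * 'rV[R]_n => sigma w t a.1.1 a.1.2 a.2),
      forall w t, (0 < t <= T)%N ->
        continuous (fun a : R * R * 'rV[R]_n => f w t a.1.1 a.1.2 a.2) &
      forall w, continuous (h w)].

(* g(t, lambda) = g(t, x, y, z Itilde). *)
Definition at_lambda {E : Type} (g : Omega -> nat -> R -> R -> 'rV[R]_n -> E)
    (w : Omega) (t : nat) (l : Lambda) : E :=
  g w t l.1.1 l.1.2 (l.2 *m Itilde).

Definition Alambda (w : Omega) (t : nat) (l : Lambda) : Lambda :=
  (- at_lambda f w t l, at_lambda b w t l, at_lambda sigma w t l *m Q t w).

Definition lipschitz_condition (c1 : R) : Prop :=
  [/\ forall w t (l l' : Lambda), (0 < t < T)%N ->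
        norm3 (Alambda w t l - Alambda w t l')
        <= c1 * normL (l - l'),
      forall w (l l' : Lambda),
        `|at_lambda b w 0 l - at_lambda b w 0 l'|
          + enorm (at_lambda sigma w 0 l *m Q 0 w
                   - at_lambda sigma w 0 l' *m Q 0 w)
        <= c1 * normL (l - l'),
      forall w (x x' : R), `|h w x - h w x'| <= c1 * `|x - x'| &
      forall w (l l' : Lambda),
        `|at_lambda f w T l - at_lambda f w T l'|
        <= c1 * (`|l.1.1 - l'.1.1| + `|l.1.2 - l'.1.2|)].

Definition monotone_condition (c2 : R) : Prop :=
  [/\ forall w t (l l' : Lambda), (0 < t < T)%N ->
        dot3 (Alambda w t l - Alambda w t l') (l - l')
        <= - c2 * normL (l - l') ^+ 2,
      forall w (l l' : Lambda),
        (- at_lambda f w T l + at_lambda f w T l') * (l.1.1 - l'.1.1)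
        <= - c2 * `|l.1.1 - l'.1.1| ^+ 2,
      forall w (l l' : Lambda),
        (at_lambda b w 0 l - at_lambda b w 0 l') * (l.1.2 - l'.1.2)
          + dotr ((at_lambda sigma w 0 l - at_lambda sigma w 0 l') *m Q 0 w)
                 (l.2 - l'.2)
        <= - c2 * (`|l.1.2 - l'.1.2| ^+ 2
                   + enorm ((l.2 - l'.2) *m Itilde) ^+ 2) &
      forall w (x x' : R),
        c2 * `|x - x'| ^+ 2 <= (h w x - h w x') * (x - x')].

(* At t = T - 1 the backward equation mentions Z T, a value outside the index
   set of Z; under the Lipschitz condition f w T ignores it. *)
Definition solves (X Y : nat -> Omega -> R)
    (Z : nat -> Omega -> 'rV[R]_n.+1) : Prop :=
  [/\ forall t w, (t < T)%N ->
        X t.+1 w - X t w = b w t (X t w) (Y t w) (Z t w *m Itilde)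
          + (sigma w t (X t w) (Y t w) (Z t w *m Itilde) *m M t.+1 w) ord0 ord0,
      forall t w, (t < T)%N ->
        Y t.+1 w - Y t w =
          - f w t.+1 (X t.+1 w) (Y t.+1 w) (Z t.+1 w *m Itilde)
          + (Z t w *m M t.+1 w) ord0 ord0,
      forall w, X 0 w = x0 &
      forall w, Y T w = h w (X T w)].

Definition adapted_solution (X Y : nat -> Omega -> R)
    (Z : nat -> Omega -> 'rV[R]_n.+1) : Prop :=
  [/\ adapted P W T X, adapted P W T Y, adapted_mx P W T.-1 Z & solves X Y Z].

(* Indistinguishability on {0, ..., T}, "almost surely" being "for every w". *)
Definition indistinguishable (U U' : nat -> Omega -> R) : Prop :=
  forall w t, (t <= T)%N -> U t w = U' t w.

Definition sim_M (Z Z' : nat -> Omega -> 'rV[R]_n.+1) : Prop :=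
  forall w t, (t < T)%N -> Z t w *m M t.+1 w = Z' t w *m M t.+1 w.

End equation.

(* Main.v *)
(* Positivity of the transition probabilities leaves no nonempty null event, so
   Omega is in effect a finite tree and an adapted process is a function of its
   nodes. The equation is solved by a decoupling field: functions v_t(w, x),
   built backwards from v_T = h + f(T, .), such that Y_t + f(t, X_t, Y_t, Z_t) =
   v_t(X_t) for every solution. Each v_t(w, .) is Lipschitz and strongly monotone.

   Given v_(t+1) at the successors i of a node, one must find (y, z) with
   v_(t+1, i)(x + b + sigma M_i) = y + z M_i. With k_i the inverse of v_(t+1, i),
   the residuals S_i = k_i(y + z M_i) - x - b - sigma M_i satisfy
   E[S^ (y^ + z^ M)] = E[k^ (y^ + z^ M)] - b^ y^ - sigma^ Q z^* for the difference
   (marked ^) of two candidates; the monotone condition makes this a strongly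
   monotone Lipschitz operator, which has a zero. The same identity, with x no
   longer fixed, gives v^_t x^ >= - <A^, lambda^> >= c2 |lambda^|^2, from which
   v_t inherits strong monotonicity and a Lipschitz bound. *)
Require Import Defs.
From HB Require Import structures.
From mathcomp Require Import all_boot all_order all_algebra.
From mathcomp Require Import all_classical all_reals all_analysis.
From mathcomp Require Import measurable_realfun ring lra.

Set Implicit Arguments.
Unset Strict Implicit.
Unset Printing Implicit Defensive.

Import Order.TTheory GRing.Theory Num.Theory.
Import numFieldNormedType.Exports.

Local Open Scope classical_set_scope.
Local Open Scope ring_scope.

(** Completeness of the matrix spaces, as Banach's fixed-point theorem requires. *)
HB.instance Definition _ (R : realType) (m p : nat) :=
  Uniform_isComplete.Build 'M[R]_(m, p) cauchy_cvg.

(** * Euclidean geometry of row vectors and zeros of strongly monotone maps *)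

Section euclidean.
Context {R : realType}.

Lemma dotrE m (u v : 'rV[R]_m) : dotr u v = \sum_j u ord0 j * v ord0 j.
Proof. by rewrite /dotr mxE; apply: eq_bigr => j _; rewrite mxE. Qed.

Lemma dotr_ge0 m (u : 'rV[R]_m) : 0 <= dotr u u.
Proof. by rewrite dotrE sumr_ge0// => j _; rewrite -expr2 sqr_ge0. Qed.

Lemma dotr_coord m (u : 'rV[R]_m) j : u ord0 j ^+ 2 <= dotr u u.
Proof.
rewrite dotrE (bigD1 j)//= expr2 lerDl sumr_ge0// => i _.
by rewrite -expr2 sqr_ge0.
Qed.

Lemma dotr_eq0 m (u : 'rV[R]_m) : dotr u u <= 0 -> u = 0.
Proof.
move=> u0; apply/rowP => j; rewrite mxE; apply/eqP.
by rewrite -sqrf_eq0 eq_le sqr_ge0 (le_trans (dotr_coord u j)).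
Qed.

Lemma enorm_sqr m (u : 'rV[R]_m) : enorm u ^+ 2 = dotr u u.
Proof. by rewrite sqr_sqrtr// dotr_ge0. Qed.

Lemma enorm_ge0 m (u : 'rV[R]_m) : 0 <= enorm u.
Proof. exact: sqrtr_ge0. Qed.

Lemma enorm0 m : enorm (0 : 'rV[R]_m) = 0.
Proof. by rewrite /enorm dotrE big1 ?sqrtr0// => j _; rewrite mxE mul0r. Qed.

Lemma coord_le_enorm m (u : 'rV[R]_m) j : `|u ord0 j| <= enorm u.
Proof.
rewrite -(ler_pXn2r (ltn0Sn 1)) ?nnegrE ?enorm_ge0// enorm_sqr.
by rewrite real_normK ?num_real// dotr_coord.
Qed.

Lemma dotrD2 m (u v : 'rV[R]_m) (r : R) :
  dotr (u - r *: v) (u - r *: v)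
  = dotr u u - r * dotr v u *+ 2 + r ^+ 2 * dotr v v.
Proof.
rewrite !dotrE -mulrnAr -sumrMnl !mulr_sumr -sumrN -!big_split/=.
by apply: eq_bigr => j _; rewrite !mxE; ring.
Qed.

Lemma dotr_mx_norm m (u : 'rV[R]_m) : dotr u u <= m%:R * `|u| ^+ 2.
Proof.
rewrite dotrE (le_trans (ler_sum _ (G := fun=> `|u| ^+ 2) _))//.
  move=> j _; rewrite -expr2 -[leLHS]real_normK ?num_real//.
  rewrite lerXn2r ?nnegrE//.
  by rewrite [leRHS]/Num.norm/= mx_normrE; apply/bigmax_geP; right; exists (ord0, j).
by rewrite sumr_const card_ord mulr_natl.
Qed.

Lemma mx_norm_dotr m (u : 'rV[R]_m) : `|u| ^+ 2 <= dotr u u.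
Proof.
have [/eqP->|u0] := boolP (`|u| == 0); first by rewrite expr0n dotr_ge0.
have [[i j] ->] : exists i, `|u| = `|u i.1 i.2| by apply: mx_norm_neq0.
by rewrite (ord1 i) /= real_normK ?num_real// dotr_coord.
Qed.

(* A zero of [G] is a fixed point of [u - r G u], a contraction for the
   Euclidean norm when [r] is small; Banach's theorem is applied in the sup norm
   to an iterate, which is a contraction for that norm as well. *)
Lemma strongly_monotone_zero m (G : 'rV[R]_m -> 'rV[R]_m) (c K : R) :
  0 < c ->
  (forall u v, c * dotr (u - v) (u - v) <= dotr (G u - G v) (u - v)) ->
  (forall u v, dotr (G u - G v) (G u - G v) <= K * dotr (u - v) (u - v)) ->
  exists u, G u = 0.
Proof.
move=> c0 monoG lipG.
(* [L] exceeds both [K], whose sign is unknown, and [c ^+ 2]. With [r = c / L] the squared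
   contraction factor 1 - 2 r c + r^2 L equals [q], which lies in [0, 1). *)
pose L := `|K| + c ^+ 2 + 1.
have L0 : 0 < L by rewrite /L; have := sqr_ge0 c; have := normr_ge0 K; lra.
have c2L : c ^+ 2 < L by rewrite /L; have := normr_ge0 K; lra.
pose r := c / L; pose q := 1 - c ^+ 2 / L.
have q0 : 0 <= q by rewrite subr_ge0 ler_pdivrMr// mul1r ltW.
have q1 : q < 1 by rewrite /q ltrBlDr ltrDl divr_gt0// exprn_gt0.
pose F u := u - r *: G u.
have FE u v : dotr (F u - F v) (F u - F v) <= q * dotr (u - v) (u - v).
  have -> : F u - F v = (u - v) - r *: (G u - G v).
    by rewrite /F scalerBr !opprD !opprK -!addrA; congr (_ + _); rewrite addrCA.
  rewrite dotrD2; set N := dotr (u - v) (u - v).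
  have N0 : 0 <= N by rewrite /N dotr_ge0.
  have r0 : 0 < r by rewrite divr_gt0.
  have h1 : r * (c * N) <= r * dotr (G u - G v) (u - v).
    by rewrite ler_pM2l//; exact: monoG.
  have h2 : r ^+ 2 * dotr (G u - G v) (G u - G v) <= r ^+ 2 * (L * N).
    rewrite ler_pM2l ?exprn_gt0//; apply: le_trans (lipG _ _) _.
    by rewrite ler_wpM2r// /L; have := ler_norm K; have := sqr_ge0 c; lra.
  have -> : q * N = N - r * (c * N) *+ 2 + r ^+ 2 * (L * N).
    by rewrite /q /r; field; rewrite gt_eqF.
  lra.
have iterE k u v : dotr (iter k F u - iter k F v) (iter k F u - iter k F v)
    <= q ^+ k * dotr (u - v) (u - v).
  elim: k => [|k IHk]; first by rewrite mul1r.
  rewrite (le_trans (FE _ _))// exprS -mulrA ler_wpM2l//.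
(* The sup norm is at most the Euclidean norm, itself at most sqrt m times the sup norm, so this [k]
   yields the contraction constant 1/2. The factor [m.+1] also ensures [q ^+ k < 1] when [m] is
   0. *)
have [k qk] : exists k, q ^+ k * m.+1%:R < 1 / 4.
  have : q ^+ n @[n --> \oo] --> (0 : R) by apply: cvg_expr; rewrite ger0_norm.
  have e0 : 0 < 1 / 4 / (m.+1%:R : R) by rewrite !divr_gt0.
  move/cvgrPdist_lt => /(_ _ e0) [k _ /(_ _ (leqnn k))].
  rewrite /= sub0r normrN ger0_norm ?exprn_ge0// => qk.
  by exists k; rewrite -ltr_pdivlMr.
pose g : {fun [set: 'rV[R]_m] >-> [set: 'rV[R]_m]} :=
  [the {fun [set: 'rV[R]_m] >-> [set: 'rV[R]_m]} of totalfun (iter k F)].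
have ctr : is_contraction g.
  have half0 : 0 <= (1 / 2 : R) by lra.
  exists (NngNum half0); split => /=; first lra.
  move=> [u v] _ /=; rewrite -(ler_pXn2r (ltn0Sn 1)) ?nnegrE ?mulr_ge0//.
  rewrite (le_trans (mx_norm_dotr _))// (le_trans (iterE _ _ _))//.
  rewrite exprMn; apply: le_trans (_ : q ^+ k * (m%:R * `|u - v| ^+ 2) <= _).
    by rewrite ler_wpM2l ?exprn_ge0// dotr_mx_norm.
  rewrite mulrA ler_wpM2r ?sqr_ge0//.
  have : q ^+ k * m%:R <= q ^+ k * m.+1%:R.
    by rewrite ler_wpM2l ?exprn_ge0// ler_nat.
  by move/le_lt_trans/(_ qk)/ltW/le_trans; apply; lra.
have [|p _ pE] := banach_fixed_point ctr closedT; first by exists 0.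
have {}pE : iter k F p = p by rewrite [RHS]pE.
exists p.
(* [F p] is a fixed point of the iterate as well, and the iterate contracts Euclidean distances,
   hence [F p = p]. *)
have := iterE k (F p) p.
rewrite -iterSr iterS pE => h.
have qk1 : q ^+ k < 1.
  apply: le_lt_trans (_ : q ^+ k * m.+1%:R < _); last by lra.
  by rewrite ler_peMr ?exprn_ge0// ler1n.
have : F p - p = 0.
  apply: dotr_eq0; have := dotr_ge0 (F p - p); nra.
rewrite /F addrC addKr => /eqP; rewrite oppr_eq0 scaler_eq0 => /orP[|/eqP//].
by rewrite gt_eqF// divr_gt0.
Qed.

(** The one-dimensional case, applied to [v - a]; it supplies the inverses of the decoupling
    fields. *)
Lemma strongly_monotone_onto (v : R -> R) (c K : R) : 0 < c ->
  (forall x x', c * (x - x') ^+ 2 <= (v x - v x') * (x - x')) ->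
  (forall x x', `|v x - v x'| <= K * `|x - x'|) ->
  forall a, exists x, v x = a.
Proof.
move=> c0 mono lip a.
pose G (u : 'rV[R]_1) : 'rV[R]_1 := const_mx (v (u ord0 ord0) - a).
have dotr1 (u w : 'rV[R]_1) : dotr u w = u ord0 ord0 * w ord0 ord0.
  by rewrite dotrE big_ord1.
have [|u w|u w|u] := @strongly_monotone_zero _ G c (K ^+ 2).
- exact: c0.
- by rewrite !dotr1 !mxE opprB addrA subrK -expr2 mono.
- rewrite !dotr1 !mxE opprB addrA subrK -!expr2 -exprMn.
  rewrite -[leLHS]real_normK ?num_real// -[leRHS]real_normK ?num_real//.
  rewrite lerXn2r ?nnegrE// normrM (le_trans (lip _ _))// ler_wpM2r//.
  exact: ler_norm.
by move/rowP/(_ ord0); rewrite !mxE => /subr0_eq; exists (u ord0 ord0).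
Qed.

End euclidean.

(** * Martingale increments at one node and solvability of the one-step system *)

Section innovation.
Context {R : realType} {n : nat}.
(** [p] is the conditional law of the next basis vector at a node, [Q] the conditional covariance
    diag(p) - p p^T, and [incr z i] the value of Z_t M_(t+1) at the successor [i]. *)
Variables (p : 'cV[R]_n.+1) (Q : 'M[R]_n.+1).
Hypotheses (p_gt0 : forall i, 0 < p i ord0) (p_sum1 : \sum_i p i ord0 = 1).
Hypothesis QE : forall i j, Q i j = p i ord0 * ((i == j)%:R - p j ord0).

Local Notation incr z i :=
  ((z *m (delta_mx i ord0 - p) : 'M[R]_(1, 1)) ord0 ord0).

Lemma incrE (z : 'rV[R]_n.+1) i :
  incr z i = z ord0 i - \sum_j p j ord0 * z ord0 j.
Proof.
rewrite mulmxBr mxE -colE !mxE; congr (_ - _).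
by apply: eq_bigr => j _; rewrite mulrC.
Qed.

(** Multiplication by [Q] weights each increment by its probability, so pairings with [z *m Q]
    become expectations. *)
Lemma incr_cov (z : 'rV[R]_n.+1) i : (z *m Q) ord0 i = p i ord0 * incr z i.
Proof.
rewrite incrE mxE mulrBr [X in X - _](_ : _ =
    \sum_j z ord0 j * p j ord0 * (j == i)%:R).
  rewrite mulr_sumr -sumrB; apply: eq_bigr => j _.
  by rewrite QE; ring.
rewrite (bigD1 i)//= eqxx big1 ?addr0; first by rewrite mulr1 mulrC.
by move=> j /negbTE ->; rewrite mulr0.
Qed.

Lemma sum_incr (z : 'rV[R]_n.+1) : \sum_i p i ord0 * incr z i = 0.
Proof.
under eq_bigr do rewrite incrE mulrBr.
by rewrite sumrB -mulr_suml p_sum1 mul1r subrr.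
Qed.

(** This is E[(y + z M)(x + s M)]: increments have mean zero, so the mixed terms drop out and the
    product of increments leaves the covariance term. *)
Lemma sum_mul_incr (y x : R) (z s : 'rV[R]_n.+1) :
  \sum_i p i ord0 * ((y + incr z i) * (x + incr s i))
  = y * x + dotr (s *m Q) z.
Proof.
pose zb := \sum_j p j ord0 * z ord0 j.
transitivity (\sum_i (y * x * p i ord0 + x * (p i ord0 * incr z i)
    + (y - zb) * (p i ord0 * incr s i) + (s *m Q) ord0 i * z ord0 i)).
  by apply: eq_bigr => i _; rewrite incr_cov (incrE z) -/zb; ring.
by rewrite !big_split/= -!mulr_sumr !sum_incr p_sum1 !mulr0 !addr0 mulr1 dotrE.
Qed.

Lemma mul_Itilde (z : 'rV[R]_n.+1) j :
  (z *m Itilde) ord0 j = z ord0 (widen_ord (leqnSn n) j) - z ord0 ord_max.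
Proof.
rewrite mxE big_ord_recr/= !mxE eqxx mulrN1; congr (_ - _).
rewrite (bigD1 j)//= big1 ?addr0 => [|i ij].
  by rewrite mxE -val_eqE/= ltn_eqF// eqxx mulr1.
rewrite mxE -val_eqE/= ltn_eqF// -[_ == _]/(i == j) (negbTE ij).
by rewrite mulr0.
Qed.

Lemma coord_le_Itilde (z : 'rV[R]_n.+1) i :
  `|z ord0 i - z ord0 ord_max| <= enorm (z *m Itilde).
Proof.
have [ni|ni] := ltnP i n; last first.
  have -> : i = ord_max.
    by apply/val_inj/eqP; rewrite /= eqn_leq ni andbT -ltnS.
  by rewrite subrr normr0 enorm_ge0.
have -> : i = widen_ord (leqnSn n) (Ordinal ni) by exact: val_inj.
by rewrite -mul_Itilde coord_le_enorm.
Qed.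

Lemma mean_le (z : 'rV[R]_n.+1) (r : R) : (forall i, `|z ord0 i| <= r) ->
  `|\sum_j p j ord0 * z ord0 j| <= r.
Proof.
move=> zr; rewrite (le_trans (ler_norm_sum _ _ _))// -[leRHS]mul1r -p_sum1.
rewrite mulr_suml ler_sum// => i _.
by rewrite normrM gtr0_norm// ler_pM2l.
Qed.

(** Adding a constant to all entries of [z] does not change the increment. Once the last entry is
    subtracted, every entry, and hence the mean, is bounded by the seminorm; this explains the
    factor 2. *)
Lemma incr_le (z : 'rV[R]_n.+1) i : `|incr z i| <= enorm (z *m Itilde) *+ 2.
Proof.
pose z' : 'rV[R]_n.+1 := \row_j (z ord0 j - z ord0 ord_max).
have -> : incr z i = z' ord0 i - \sum_j p j ord0 * z' ord0 j.
  rewrite incrE mxE; under [in RHS]eq_bigr do rewrite mxE mulrBr.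
  by rewrite sumrB -mulr_suml p_sum1; ring.
rewrite (le_trans (ler_normB _ _))// mulr2n lerD//.
  by rewrite mxE coord_le_Itilde.
by apply: mean_le => j; rewrite mxE coord_le_Itilde.
Qed.

(** Because of this, uniqueness of [z *m Itilde] yields uniqueness up to [sim_M]. *)
Lemma incr_Itilde (z z' : 'rV[R]_n.+1) i : z *m Itilde = z' *m Itilde ->
  incr z i = incr z' i.
Proof.
move=> zz'; apply/subr0_eq/eqP; rewrite -normr_le0.
have := incr_le (z - z') i; rewrite [_ *m Itilde]mulmxBl zz' subrr enorm0 mul0rn.
by rewrite mulmxBl [X in `|X|]mxE [X in _ + X]mxE.
Qed.

(** Each squared entry is at most 4 |z|^2, which gives the constant 4n for squared norms;
    [4 * n%:R + 1] dominates its square root. *)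
Lemma enorm_Itilde (z : 'rV[R]_n.+1) :
  enorm (z *m Itilde) <= (4 * n%:R + 1) * enorm z.
Proof.
have b0 : 0 <= (4 * n%:R + 1) * enorm z.
  by rewrite mulr_ge0 ?enorm_ge0// addr_ge0// mulr_ge0.
rewrite -(ler_pXn2r (ltn0Sn 1)) ?nnegrE ?enorm_ge0// exprMn !enorm_sqr.
have h : dotr (z *m Itilde) (z *m Itilde) <= 4 * n%:R * dotr z z.
  rewrite [leLHS]dotrE (le_trans (ler_sum _ (G := fun=> 4 * dotr z z) _))//.
    move=> j _; rewrite mul_Itilde.
    set a := z _ _; set b := z _ _.
    have := dotr_coord z (widen_ord (leqnSn n) j).
    have := dotr_coord z ord_max; rewrite -/a -/b.
    by have := sqr_ge0 (a + b); nra.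
  by rewrite sumr_const card_ord -[leLHS]mulr_natr [leLHS]mulrAC.
apply: (le_trans h); rewrite ler_wpM2r ?dotr_ge0//.
have : (0 : R) <= n%:R by [].
nra.
Qed.

(* The unknown is the row [a] of the values at the [n.+1] successors of the
   node: it encodes [y] as its mean and [z] as itself. *)
Lemma one_step_zero (k : 'I_n.+1 -> R -> R) (beta : R -> 'rV[R]_n.+1 -> R)
    (s : R -> 'rV[R]_n.+1 -> 'rV[R]_n.+1) (x c L K : R) :
  0 < c -> 0 <= L -> 0 <= K ->
  (forall i a a', 0 <= (k i a - k i a') * (a - a')) ->
  (forall i a a', `|k i a - k i a'| <= K * `|a - a'|) ->
  (forall y z y' z',
    `|beta y z - beta y' z'| + enorm (s y z *m Q - s y' z' *m Q)
    <= L * (`|y - y'| + enorm ((z - z') *m Itilde))) ->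
  (forall y z y' z',
    (beta y z - beta y' z') * (y - y')
      + dotr ((s y z - s y' z') *m Q) (z - z')
    <= - c * (`|y - y'| ^+ 2 + enorm ((z - z') *m Itilde) ^+ 2)) ->
  exists y z, forall i, k i (y + incr z i) = x + beta y z + incr (s y z) i.
Proof.
move=> c0 L0 K0 monok lipk lipbs monobs.
pose y (a : 'rV[R]_n.+1) := \sum_j p j ord0 * a ord0 j.
have yB (a a' : 'rV[R]_n.+1) : y a - y a' = y (a - a').
  by rewrite /y -sumrB; apply: eq_bigr => j _; rewrite !mxE mulrBr.
have yincr (a : 'rV[R]_n.+1) i : a ord0 i = y a + incr a i by rewrite incrE addrC subrK.
(* Entry [i] is p_i times the residual at successor [i]. The increment of [s] is written through
   [Q], the only form in which the hypotheses bound it. *)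
pose G (a : 'rV[R]_n.+1) : 'rV[R]_n.+1 := \row_i (p i ord0 *
  (k i (a ord0 i) - x - beta (y a) a) - (s (y a) a *m Q) ord0 i).
have p_le1 i : p i ord0 <= 1.
  by rewrite -p_sum1 (bigD1 i)//= lerDl sumr_ge0// => j _; exact: ltW.
(* Entrywise Lipschitz constant of [G]: [K] comes from the [k i], and 4n + 2 adds the bound 1 on the
   mean to that of [enorm_Itilde]. *)
pose D : R := K + L * (4 * n%:R + 2).
have [|a a'|a a'|a Ga0] :=
    @strongly_monotone_zero _ _ G (c / 8 / n.+1%:R) (n.+1%:R * D ^+ 2).
- by rewrite !divr_gt0.
- have := monobs (y a) a (y a') a'.
  set e := enorm _; set N := dotr (a - a') _ => mono.
  (* An entry of [a - a'] is its mean plus an increment, at most u + 2e in absolute value, and (u +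
     2e)^2 <= 8 (u^2 + e^2). *)
  have NE : N <= n.+1%:R * (8 * (`|y a - y a'| ^+ 2 + e ^+ 2)).
    rewrite /N dotrE.
    rewrite (le_trans (ler_sum _ (G := fun=> 8 * (`|y a - y a'| ^+ 2 + e ^+ 2)) _))//.
      move=> i _; rewrite -expr2 -[leLHS]real_normK ?num_real//.
      have := yincr (a - a') i; rewrite -yB => ->.
      have := incr_le (a - a') i; rewrite -/e.
      have := ler_normD (y a - y a') (incr (a - a') i).
      set u := `|y a - _|; set w := `|incr _ i|; set t := `|_ + _| => h1 h2.
      have : t <= u + e *+ 2 by lra.
      have u0 : 0 <= u by rewrite /u.
      have t0 : 0 <= t by rewrite /t.
      have e0 : 0 <= e by rewrite /e enorm_ge0.
      move=> tue.
      have : t ^+ 2 <= (u + e *+ 2) ^+ 2.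
        by rewrite lerXn2r// nnegrE; lra.
      have := sqr_ge0 (u - e *+ 2); nra.
    by rewrite sumr_const card_ord [leRHS]mulr_natl.
  (* The fixed [x] cancels. The sum is nonnegative by monotonicity of the [k i], and the subtracted
     part is bounded by the monotone condition. *)
  have -> : dotr (G a - G a') (a - a') =
      \sum_i p i ord0 * ((k i (a ord0 i) - k i (a' ord0 i))
                         * (a ord0 i - a' ord0 i))
      - ((beta (y a) a - beta (y a') a') * (y a - y a')
        + dotr ((s (y a) a - s (y a') a') *m Q) (a - a')).
    rewrite [in RHS]yB /y !dotrE mulr_sumr -big_split -sumrB/=.
    by apply: eq_bigr => i _; rewrite mulmxBl !mxE; ring.
  apply: (@le_trans _ _ (c * (`|y a - y a'| ^+ 2 + e ^+ 2))).
    apply: (@le_trans _ _ (c / 8 / n.+1%:R *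
      (n.+1%:R * (8 * (`|y a - y a'| ^+ 2 + e ^+ 2))))).
      by rewrite ler_pM2l// !divr_gt0.
    rewrite le_eqVlt; apply/orP; left; apply/eqP.
    by move: (n.+1%:R : R) (pnatr_eq0 R n.+1) => w w0; field; rewrite w0.
  set ks := \sum_i _; have ks0 : 0 <= ks.
    by rewrite sumr_ge0// => i _; rewrite mulr_ge0// ltW.
  by move: mono ks0; lra.
- have := lipbs (y a) a (y a') a'.
  set d := a - a' => lip.
  rewrite -[in leRHS]enorm_sqr; set r := enorm d.
  have r0 : 0 <= r by exact: enorm_ge0.
  have D0 : 0 <= D.
    by rewrite /D addr_ge0// mulr_ge0// addr_ge0// mulr_ge0.
  have {}lip : `|beta (y a) a - beta (y a') a'|
      + enorm (s (y a) a *m Q - s (y a') a' *m Q) <= L * (4 * n%:R + 2) * r.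
    apply: (le_trans lip); rewrite -mulrA ler_wpM2l//.
    have := enorm_Itilde d; rewrite -/r.
    have : `|y a - y a'| <= r.
      by rewrite yB; apply: mean_le => i; exact: coord_le_enorm.
    lra.
  rewrite dotrE (le_trans (ler_sum _ (G := fun=> (D * r) ^+ 2) _))//; last first.
    by rewrite sumr_const card_ord exprMn -mulrA [leRHS]mulr_natl.
  move=> i _; rewrite -expr2 -[leLHS]real_normK ?num_real//.
  rewrite lerXn2r ?nnegrE ?mulr_ge0//.
  have -> : (G a - G a') ord0 i = p i ord0 *
     ((k i (a ord0 i) - k i (a' ord0 i)) - (beta (y a) a - beta (y a') a'))
     - (s (y a) a *m Q - s (y a') a' *m Q) ord0 i.
    by rewrite !mxE; ring.
  have := coord_le_enorm (s (y a) a *m Q - s (y a') a' *m Q) i.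
  set sq := (s (y a) a *m Q - s (y a') a' *m Q) ord0 i => hsq.
  have := lipk i (a ord0 i) (a' ord0 i).
  have : `|a ord0 i - a' ord0 i| <= r.
    by have := coord_le_enorm d i; rewrite /d !mxE.
  move=> /(ler_wpM2l K0) h1 h2.
  apply: (le_trans (ler_normB _ _)); rewrite normrM (gtr0_norm (p_gt0 i)).
  set kk := k i (a ord0 i) - _ in h2 *; set bb := beta (y a) a - _ in lip *.
  have : p i ord0 * `|kk - bb| <= `|kk| + `|bb|.
    by rewrite (le_trans _ (ler_normB _ _))// ler_piMl.
  rewrite /D mulrDl; lra.
exists (y a), a => i; rewrite -yincr.
(* Each p_i is positive, so a zero of [G] annihilates every residual. *)
pose S i := k i (a ord0 i) - x - beta (y a) a - incr (s (y a) a) i.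
have S0 j : S j = 0.
  move/rowP: Ga0 => /(_ j); rewrite /G mxE [RHS]mxE incr_cov -mulrBr => /eqP.
  by rewrite mulf_eq0 gt_eqF//= => /eqP.
by have := S0 i; rewrite /S; lra.
Qed.

End innovation.

(** * The decoupling field on the tree of nodes *)

Section decoupling_field.
Context {d : measure_display} {Omega : measurableType d} {R : realType}.
Context {n : nat}.
Variables (T : nat) (W M : nat -> Omega -> 'cV[R]_n.+1).
Variables (Q : nat -> Omega -> 'M[R]_n.+1) (x0 : R).
Variables (b f : Omega -> nat -> R -> R -> 'rV[R]_n -> R).
Variables (sigma : Omega -> nat -> R -> R -> 'rV[R]_n -> 'rV[R]_n.+1).
Variables (h : Omega -> R -> R) (c1 c2 : R) (p : nat -> Omega -> 'cV[R]_n.+1).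

(** The equivalence classes are the nodes of the tree at time [t]. *)
Definition agree t w w' := forall s, (s <= t)%N -> W s w = W s w'.

Lemma agree_refl t w : agree t w w.
Proof. by []. Qed.

Arguments agree_refl t w s _ : clear implicits.

Lemma agree_sym t w w' : agree t w w' -> agree t w' w.
Proof. by move=> ww' s /ww'. Qed.

Lemma agree_trans t w1 w2 w3 : agree t w1 w2 -> agree t w2 w3 -> agree t w1 w3.
Proof. by move=> e e' s st; rewrite e// e'. Qed.

Lemma agree_le t t' w w' : (t <= t')%N -> agree t' w w' -> agree t w w'.
Proof. by move=> tt' ww' s st; apply/ww'/leq_trans/tt'. Qed.

Lemma agreeS t w w' : agree t w w' -> W t.+1 w = W t.+1 w' -> agree t.+1 w w'.
Proof. by move=> ww' e s; rewrite leq_eqVlt => /predU1P[->//|]; exact: ww'. Qed.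

(* A function of the node reached at time [t]; under [positive_transitions] this
   is what measurability with respect to F_t amounts to. *)
Definition node_fun {E : Type} t (g : Omega -> E) :=
  forall w w', agree t w w' -> g w = g w'.

(** The probabilistic setting enters only through these facts about the tree, with [p] the
    transition probabilities; no measure appears in this section. *)
Hypothesis W_basis : basis_valued T W.
Hypothesis p_gt0 : forall t w i, (t < T)%N -> 0 < p t w i ord0.
Hypothesis p_sum1 : forall t w, (t < T)%N -> \sum_i p t w i ord0 = 1.
Hypothesis p_node : forall t, (t < T)%N -> node_fun t (p t).
Hypothesis ME : forall t w, (t < T)%N -> M t.+1 w = W t.+1 w - p t w.
Hypothesis successor : forall t w (i : 'I_n.+1), (t < T)%N ->
  exists2 w', agree t w w' & W t.+1 w' = delta_mx i ord0.
Hypothesis QE : forall t w i j, (t < T)%N ->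
  Q t w i j = p t w i ord0 * ((i == j)%:R - p t w j ord0).
Hypothesis b_node : forall t, (t < T)%N -> node_fun t (b ^~ t).
Hypothesis sigma_node : forall t, (t < T)%N -> node_fun t (sigma ^~ t).
Hypothesis f_node : forall t, (0 < t <= T)%N -> node_fun t (f ^~ t).
Hypothesis h_node : node_fun T h.
Hypotheses (T_gt0 : (0 < T)%N) (c1_gt0 : 0 < c1) (c2_gt0 : 0 < c2).
Hypothesis coef_lipschitz : lipschitz_condition T Q b f sigma h c1.
Hypothesis coef_monotone : monotone_condition T Q b f sigma h c2.

Local Notation I := (@Itilde R n).

Lemma M_successor t w w' i : (t < T)%N -> agree t w w' ->
  W t.+1 w' = delta_mx i ord0 -> M t.+1 w' = delta_mx i ord0 - p t w.
Proof. by move=> tT ww' Wi; rewrite ME// Wi (p_node tT ww'). Qed.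

Lemma lipschitz_b_sigma t w x y z y' z' : (t < T)%N ->
  `|b w t x y (z *m I) - b w t x y' (z' *m I)|
    + enorm (sigma w t x y (z *m I) *m Q t w - sigma w t x y' (z' *m I) *m Q t w)
  <= c1 * (`|y - y'| + enorm ((z - z') *m I)).
Proof.
have [lipA lip0 _ _] := coef_lipschitz; case: t => [_|t tT].
  have := lip0 w (x, y, z) (x, y', z').
  by rewrite /at_lambda /normL /= subrr normr0 add0r.
have := lipA w t.+1 (x, y, z) (x, y', z') tT.
rewrite /Alambda /at_lambda /norm3 /normL /= subrr normr0 add0r => lip.
by apply: le_trans lip; rewrite lerD2r lerDr.
Qed.

(** With equal [x] the [f] term is paired with zero. For t > 0 the square of |y| + |z Itilde|
    dominates the sum of squares that is given at t = 0. *)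
Lemma monotone_b_sigma t w x y z y' z' : (t < T)%N ->
  (b w t x y (z *m I) - b w t x y' (z' *m I)) * (y - y')
    + dotr ((sigma w t x y (z *m I) - sigma w t x y' (z' *m I)) *m Q t w) (z - z')
  <= - c2 * (`|y - y'| ^+ 2 + enorm ((z - z') *m I) ^+ 2).
Proof.
have [monoA _ mono0 _] := coef_monotone; case: t => [_|t tT].
  exact: mono0 w (x, y, z) (x, y', z').
have := monoA w t.+1 (x, y, z) (x, y', z') tT.
rewrite /Alambda /at_lambda /dot3 /normL /= -mulmxBl subrr mulr0 normr0 !add0r.
move=> /le_trans; apply; rewrite !mulNr lerN2 ler_pM2l//.
have := enorm_ge0 ((z - z') *m I); have := normr_ge0 (y - y'); nra.
Qed.

(** The monotonicity constant is [c2] at every time and is reproduced by the recursion; of the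
    Lipschitz bound only existence, uniform in [w], is recorded. *)
Definition field_ok t (v : Omega -> R -> R) :=
  [/\ node_fun t v,
      forall w x x', c2 * (x - x') ^+ 2 <= (v w x - v w x') * (x - x') &
      exists2 L, 0 <= L & forall w x x', `|v w x - v w x'| <= L * `|x - x'|].

(* [v w] sends the value of [X] at time [t.+1] to that of [Y + f]; [yz] is then
   the value of [(Y, Z)] at time [t] when [X] is [x] there. *)
Definition one_step t (v : Omega -> R -> R) w x (yz : R * 'rV[R]_n.+1) :=
  forall w', agree t w w' ->
    v w' (x + b w t x yz.1 (yz.2 *m I)
          + (sigma w t x yz.1 (yz.2 *m I) *m M t.+1 w') ord0 ord0)
    = yz.1 + (yz.2 *m M t.+1 w') ord0 ord0.

Lemma one_step_exists t v w x : (t < T)%N -> field_ok t.+1 v ->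
  exists yz, one_step t v w x yz.
Proof.
move=> tT [v_node v_mono [L _ v_lip]].
(* One representative outcome per successor node suffices, since [v] depends only on the node. *)
have /choice[sc scP] i : exists w', agree t w w' /\ W t.+1 w' = delta_mx i ord0.
  by have [w' ? ?] := successor w i tT; exists w'.
(* [k (i, _)] inverts the field at [sc i]; strong monotonicity of the field makes it monotone and
   Lipschitz with constant [c2^-1]. *)
have /choice[k kP] (ia : 'I_n.+1 * R) : exists x', v (sc ia.1) x' = ia.2.
  exact: strongly_monotone_onto c2_gt0 (v_mono (sc ia.1)) (v_lip (sc ia.1)) ia.2.
have k_mono i a a' :
    c2 * (k (i, a) - k (i, a')) ^+ 2 <= (a - a') * (k (i, a) - k (i, a')).
  by rewrite (le_trans (v_mono (sc i) _ _))// (kP (i, a)) (kP (i, a')).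
have [|||i a a'|i a a'|y z y' z'|y z y' z'|y [z yzP]] := @one_step_zero R n (p t w)
    (Q t w) (fun i => p_gt0 w i tT) (p_sum1 w tT) (fun i j => QE w i j tT)
    (fun i a => k (i, a)) (fun y z => b w t x y (z *m I))
    (fun y z => sigma w t x y (z *m I)) x c2 c1 c2^-1.
- exact: c2_gt0.
- exact: ltW.
- by rewrite invr_ge0 ltW.
- by rewrite mulrC (le_trans _ (k_mono i a a'))// mulr_ge0 ?sqr_ge0// ltW.
- set u := k _ - _; rewrite ler_pdivlMl//.
  have [->|u0] := eqVneq u 0; first by rewrite normr0 mulr0.
  have u1 : 0 < `|u| by rewrite normr_gt0.
  rewrite -(ler_pM2r u1) -normrM -mulrA -expr2 real_normK ?num_real//.
  by rewrite (le_trans (k_mono i a a'))// ler_norm.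
- exact: lipschitz_b_sigma.
- exact: monotone_b_sigma.
exists (y, z) => w' ww' /=.
have [i Wi] := W_basis w' tT.
have [sci1 sci2] := scP i.
have -> : v w' = v (sc i).
  apply: v_node; apply: agreeS; last by rewrite Wi sci2.
  exact: agree_trans (agree_sym ww') sci1.
rewrite (M_successor tT ww' Wi) -yzP; exact: (kP (i, y + _)).
Qed.

(** By [sum_mul_incr] the expression is the expectation, over the successors, of the difference of
    field values times the difference of next states; each term is nonnegative by monotonicity of
    [v]. *)
Lemma one_step_monotone t v w x yz x' yz' : (t < T)%N -> field_ok t.+1 v ->
  one_step t v w x yz -> one_step t v w x' yz' ->
  0 <= (yz.1 - yz'.1) * (x - x' + (b w t x yz.1 (yz.2 *m I)
                                    - b w t x' yz'.1 (yz'.2 *m I)))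
       + dotr ((sigma w t x yz.1 (yz.2 *m I)
                - sigma w t x' yz'.1 (yz'.2 *m I)) *m Q t w) (yz.2 - yz'.2).
Proof.
move=> tT [_ v_mono _] st st'.
rewrite -(sum_mul_incr (p_sum1 w tT) (fun i j => QE w i j tT)).
rewrite sumr_ge0// => i _; apply: mulr_ge0; first exact/ltW/p_gt0.
have [w' ww' Wi] := successor w i tT.
have := v_mono w' (x + b w t x yz.1 (yz.2 *m I)
          + (sigma w t x yz.1 (yz.2 *m I) *m M t.+1 w') ord0 ord0)
  (x' + b w t x' yz'.1 (yz'.2 *m I)
          + (sigma w t x' yz'.1 (yz'.2 *m I) *m M t.+1 w') ord0 ord0).
rewrite st// st'// (M_successor tT ww' Wi).
set dx := (X in c2 * X ^+ 2 <= _) => mono.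
have : 0 <= c2 * dx ^+ 2 by rewrite mulr_ge0 ?sqr_ge0// ltW.
move=> /le_trans/(_ mono); rewrite /dx => cov0; apply: (le_trans cov0).
have BE (u u' : 'M[R]_1) : (u - u') ord0 ord0 = u ord0 ord0 - u' ord0 ord0.
  by rewrite !mxE.
rewrite le_eqVlt; apply/orP; left; apply/eqP; rewrite !mulmxBl !BE; ring.
Qed.

(** For equal [x] the pairing is nonnegative by [one_step_monotone] and at most [- c2] times the
    squared differences by [monotone_b_sigma]. In [z] only the seminorm is controlled. *)
Lemma one_step_unique t v w x yz yz' : (t < T)%N -> field_ok t.+1 v ->
  one_step t v w x yz -> one_step t v w x yz' ->
  yz.1 = yz'.1 /\ yz.2 *m I = yz'.2 *m I.
Proof.
move=> tT v_ok st st'.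
have := one_step_monotone tT v_ok st st'; rewrite subrr add0r mulrC => cov.
have := le_trans cov (monotone_b_sigma w x _ _ _ _ tT).
rewrite mulNr oppr_ge0 pmulr_rle0// real_normK ?num_real// => le0.
have e0 := enorm_ge0 ((yz.2 - yz'.2) *m I).
split.
  apply/subr0_eq/eqP; rewrite -sqrf_eq0 eq_le sqr_ge0 andbT.
  by apply: le_trans le0; rewrite lerDl sqr_ge0.
apply/subr0_eq; rewrite -mulmxBl; apply: dotr_eq0; rewrite -enorm_sqr.
by apply: le_trans le0; rewrite lerDr sqr_ge0.
Qed.

(** The default [(0, 0)] is reached only if no one-step solution exists, which [solP] excludes for
    the fields considered. *)
Definition sol t (v : Omega -> R -> R) w x : R * 'rV[R]_n.+1 :=
  xget (0, 0) [set yz | one_step t v w x yz].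

Lemma solP t v w x : (t < T)%N -> field_ok t.+1 v -> one_step t v w x (sol t v w x).
Proof.
move=> tT v_ok; have [yz yzP] := one_step_exists w x tT v_ok.
exact: (@xgetPex _ (0, 0) [set yz | one_step t v w x yz] (ex_intro _ yz yzP)).
Qed.

Arguments solP {t v} w x _ _ w' _.

(** The set of one-step solutions is the same at all outcomes of a node, and [xget] depends on that
    set alone; adaptedness thus needs no measurable selection. *)
Lemma sol_node t v : (t < T)%N -> node_fun t (sol t v).
Proof.
move=> tT w w' ww'; apply/funext => x; rewrite /sol; congr (xget _ _).
apply/seteqP; split => yz /= st w'' ww''.
  by rewrite -(b_node tT ww') -(sigma_node tT ww') st//; exact: agree_trans ww''.
rewrite (b_node tT ww') (sigma_node tT ww') st//.
exact: agree_trans (agree_sym ww') ww''.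
Qed.

Definition backstep t v w x : R :=
  (sol t v w x).1 + f w t x (sol t v w x).1 ((sol t v w x).2 *m I).

Lemma backstep_ok t v : (0 < t < T)%N -> field_ok t.+1 v ->
  field_ok t (backstep t v).
Proof.
move=> /[dup] t0T /andP[t0 tT] v_ok.
have [lipA _ _ _] := coef_lipschitz; have [monoA _ _ _] := coef_monotone.
(* [N] is |lambda^| for the two one-step solutions. Subtracting the monotone condition from
   [one_step_monotone] cancels the [b] and [sigma] terms and leaves (y^ + f^) x^ >= c2 N^2. *)
have key w x x' :
    let u := sol t v w x in let u' := sol t v w x' in
    let N := normL ((x, u.1, u.2) - (x', u'.1, u'.2)) in
    [/\ c2 * N ^+ 2 <= (backstep t v w x - backstep t v w x') * (x - x'),
        `|backstep t v w x - backstep t v w x'| <= (1 + c1) * N & `|x - x'| <= N].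
  move=> u u' N.
  have := one_step_monotone tT v_ok (solP w x tT v_ok) (solP w x' tT v_ok).
  rewrite -/u -/u' => cov.
  have := monoA w t (x, u.1, u.2) (x', u'.1, u'.2) t0T.
  have := lipA w t (x, u.1, u.2) (x', u'.1, u'.2) t0T.
  rewrite /norm3 /dot3 /Alambda /at_lambda -/N /= -mulmxBl => lip mono.
  have xN : `|x - x'| + `|u.1 - u'.1| <= N by rewrite /N/normL/= lerDl enorm_ge0.
  rewrite /backstep -/u -/u'; split.
  - by move: mono cov; lra.
  - move: lip; set e1 := enorm _; set fx := f w t x _ _; set fx' := f w t x' _ _.
    have e10 : 0 <= e1 by exact: enorm_ge0.
    rewrite opprK -normrN opprD opprK; set bb := `|b _ _ _ _ _ - _| => lip.
    have bb0 : 0 <= bb by exact: normr_ge0.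
    rewrite (_ : _ - _ = (u.1 - u'.1) + (fx - fx')); last by ring.
    rewrite (le_trans (ler_normD _ _))//.
    by have := normr_ge0 (x - x'); lra.
  - by have := normr_ge0 (u.1 - u'.1); lra.
split.
- move=> w w' ww'; apply/funext => x; rewrite /backstep (sol_node v tT ww').
  by rewrite (f_node _ ww')// t0 ltnW.
- move=> w x x'; have [mono _ xN] := key w x x'; apply: le_trans mono.
  rewrite ler_pM2l// -[leLHS]real_normK ?num_real// lerXn2r// nnegrE.
  exact: le_trans xN.
(* From c2 N^2 <= |B| |x - x'| and |B| <= (1 + c1) N follows N <= (1 + c1) / c2 |x - x'|, and then
   the bound on |B|. *)
exists ((1 + c1) ^+ 2 / c2); first by rewrite divr_ge0 ?sqr_ge0// ltW.
move=> w x x'; have := key w x x'.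
move=> /=; set N := normL _; set B := backstep t v w x - _; move=> [mono lip xN].
have N0 : 0 <= N by exact: le_trans xN.
have : c2 * N <= (1 + c1) * `|x - x'|.
  have [->|N1] := eqVneq N 0; first by rewrite mulr0 mulr_ge0// addr_ge0// ltW.
  have {}N1 : 0 < N by rewrite lt_def N1.
  rewrite -(ler_pM2r N1) -mulrA -expr2 (le_trans mono)// (le_trans (ler_norm _))//.
  by rewrite normrM [leRHS]mulrAC ler_wpM2r.
rewrite -ler_pdivlMl// => Nx.
have c10 : 0 < 1 + c1 by exact: addr_gt0.
apply: (le_trans lip).
have -> : (1 + c1) ^+ 2 / c2 * `|x - x'|
    = (1 + c1) * (c2^-1 * ((1 + c1) * `|x - x'|)) by ring.
by rewrite ler_pM2l.
Qed.

(** Recursion on the number of steps before the horizon. In the terminal field [0 *m I] stands in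
    for the value at [Z T]; by [f_terminal] any choice gives the same field. *)
Fixpoint field_before k : Omega -> R -> R :=
  if k is k'.+1 then backstep (T - k) (field_before k')
  else fun w x => h w x + f w T x (h w x) (0 *m I).

Definition field t := field_before (T - t).

Lemma fieldE t : (t < T)%N -> field t = backstep t (field t.+1).
Proof. by move=> tT; rewrite /field -subnSK//= subnSK// subKn// ltnW. Qed.

Lemma f_terminal w x y z z' : f w T x y (z *m I) = f w T x y (z' *m I).
Proof.
have [_ _ _ lipT] := coef_lipschitz.
have := lipT w (x, y, z) (x, y, z'); rewrite /at_lambda /= !subrr normr0 addr0.
by rewrite mulr0 normr_le0 => /eqP/subr0_eq.
Qed.

Lemma field_ok_terminal : field_ok T (field T).
Proof.
rewrite /field subnn /=.
have [_ _ lip_h lip_f] := coef_lipschitz.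
have [_ mono_f _ mono_h] := coef_monotone.
split.
- move=> w w' ww'; apply/funext => x.
  by rewrite (h_node ww') (f_node _ ww')// T_gt0 /=.
- move=> w x x'; have := mono_h w x x'.
  have := mono_f w (x, h w x, 0) (x', h w x', 0); rewrite /at_lambda /=.
  rewrite !real_normK ?num_real//.
  by have := mulr_ge0 (ltW c2_gt0) (sqr_ge0 (x - x')); lra.
exists (c1 + c1 * (1 + c1)).
  by rewrite addr_ge0 ?mulr_ge0 ?addr_ge0// ltW.
move=> w x x'; have hx := lip_h w x x'.
have := lip_f w (x, h w x, 0) (x', h w x', 0); rewrite /at_lambda /=.
set fx := f w T x _ _; set fx' := f w T x' _ _ => fx_lip.
rewrite (_ : _ - _ = (h w x - h w x') + (fx - fx')); last by ring.
rewrite (le_trans (ler_normD _ _))//.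
have := ler_wpM2l (ltW c1_gt0) hx; lra.
Qed.

(** Backward induction that stops at time 1: the monotone condition at time 0 gives no control in
    [x], and there only the state [x0] occurs. *)
Lemma field_field_ok t : (0 < t <= T)%N -> field_ok t (field t).
Proof.
move=> /andP[t0 tT]; rewrite -(subKn tT).
have : (T - t < T)%N by rewrite ltn_subrL t0.
elim: (T - t)%N => [_|k IHk kT]; first by rewrite subn0; exact: field_ok_terminal.
rewrite fieldE ?ltn_subrL//; apply: backstep_ok.
  by rewrite subn_gt0 kT ltn_subrL T_gt0.
by rewrite subnSK 1?ltnW//; apply: IHk; exact: ltnW.
Qed.

Lemma fieldS_ok t : (t < T)%N -> field_ok t.+1 (field t.+1).
Proof. by move=> tT; apply: field_field_ok. Qed.

(** * Forward construction of the solution, and uniqueness *)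

Fixpoint fwd t w : R :=
  if t is t'.+1 then
    let x := fwd t' w in let yz := sol t' (field t) w x in
    x + b w t' x yz.1 (yz.2 *m I)
      + (sigma w t' x yz.1 (yz.2 *m I) *m M t w) ord0 ord0
  else x0.

(** At the horizon the second component is a filler for [Z T], outside the index set of Z. *)
Definition bwd t w : R * 'rV[R]_n.+1 :=
  if (t < T)%N then sol t (field t.+1) w (fwd t w) else (h w (fwd t w), 0).

Lemma bwd_lt t w : (t < T)%N -> bwd t w = sol t (field t.+1) w (fwd t w).
Proof. by rewrite /bwd => ->. Qed.

Lemma M_node t : (t < T)%N -> node_fun t.+1 (M t.+1).
Proof.
move=> tT w w' ww'; rewrite !ME// (ww' t.+1)//.
by rewrite (p_node tT (agree_le (leqnSn t) ww')).
Qed.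

Lemma fwd_node t : (t <= T)%N -> node_fun t (fwd t).
Proof.
elim: t => [//|t IHt] tT w w' ww' /=.
have wt := agree_le (leqnSn t) ww'.
rewrite (IHt (ltnW tT) _ _ wt) (sol_node _ tT wt) (b_node tT wt).
by rewrite (sigma_node tT wt) (M_node tT ww').
Qed.

Lemma bwd_node t : (t <= T)%N -> node_fun t (bwd t).
Proof.
move=> tT w w' ww'; rewrite /bwd; case: ltnP => [tT'|Tt].
  by rewrite (sol_node _ tT' ww') (fwd_node tT ww').
have -> : h w = h w' by apply/h_node/agree_le/ww'.
by rewrite (fwd_node tT ww').
Qed.

Lemma field_bwd t w : (0 < t <= T)%N ->
  field t w (fwd t w)
  = (bwd t w).1 + f w t (fwd t w) (bwd t w).1 ((bwd t w).2 *m I).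
Proof.
move=> /andP[t0]; rewrite leq_eqVlt => /predU1P[->|tT].
  by rewrite /bwd ltnn /field subnn.
by rewrite fieldE// bwd_lt.
Qed.

(** The backward equation compares two expressions for the field at X_(t+1): Y_t + Z_t M_(t+1) by
    [solP], and Y_(t+1) + f by [field_bwd]. *)
Lemma fwd_bwd_solves :
  solves T M x0 b f sigma h fwd (fun t w => (bwd t w).1) (fun t w => (bwd t w).2).
Proof.
split => [t w tT|t w tT|//|w].
- by rewrite bwd_lt//=; ring.
- have st := solP w (fwd t w) tT (fieldS_ok tT).
  have := st w (agree_refl t w); rewrite -bwd_lt//.
  have -> : fwd t w + b w t (fwd t w) (bwd t w).1 ((bwd t w).2 *m I)
     + (sigma w t (fwd t w) (bwd t w).1 ((bwd t w).2 *m I) *m M t.+1 w) ord0 ord0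
     = fwd t.+1 w by rewrite bwd_lt.
  by rewrite field_bwd//; lra.
- by rewrite /bwd ltnn.
Qed.

(** Backward induction alternating two implications. If the field at X_(t+1) is Y_(t+1) + f, the
    equation at time t is a one-step problem; [one_step_unique] then identifies its solution with
    [sol], so the field at X_t is Y_t + f. *)
Lemma solves_field X Y Z :
  (forall t, (t <= T)%N -> node_fun t (X t)) ->
  (forall t, (t <= T)%N -> node_fun t (Y t)) ->
  (forall t, (t < T)%N -> node_fun t (Z t)) ->
  solves T M x0 b f sigma h X Y Z ->
  forall t, (t < T)%N ->
  forall w, one_step t (field t.+1) w (X t w) (Y t w, Z t w).
Proof.
move=> X_node Y_node Z_node [eqX eqY _ YT].
pose yf t w := Y t w + f w t (X t w) (Y t w) (Z t w *m I).
have step_of_field t : (t < T)%N ->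
    (forall w, field t.+1 w (X t.+1 w) = yf t.+1 w) ->
    forall w, one_step t (field t.+1) w (X t w) (Y t w, Z t w).
  move=> tT fieldY w w' ww' /=.
  rewrite (X_node t (ltnW tT) _ _ ww') (Y_node t (ltnW tT) _ _ ww').
  rewrite (Z_node t tT _ _ ww') (b_node tT ww') (sigma_node tT ww').
  have := eqX t w' tT; have := eqY t w' tT => eY eX.
  rewrite -addrA -eX addrC subrK fieldY /yf.
  by move: eY; lra.
have field_of_step t : (0 < t < T)%N ->
    (forall w, one_step t (field t.+1) w (X t w) (Y t w, Z t w)) ->
    forall w, field t w (X t w) = yf t w.
  move=> /andP[t0 tT] st w; rewrite fieldE// /backstep /yf.
  have v_ok := fieldS_ok tT.
  have [-> ->] // := one_step_unique tT v_ok (solP w (X t w) tT v_ok) (st w).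
suff fieldY k : (k < T)%N -> forall w, 
    field (T - k)%N w (X (T - k)%N w) = yf (T - k)%N w.
  move=> t tT; apply: step_of_field => //.
  by rewrite -(subKn tT); apply: fieldY; rewrite ltn_subrL T_gt0.
elim: k => [_ w|k IHk kT].
  by rewrite subn0 /field subnn /yf /= YT (f_terminal _ _ _ 0 (Z T w)).
have kT' : (T - k.+1 < T)%N by rewrite ltn_subrL T_gt0.
apply: field_of_step; first by rewrite subn_gt0 kT.
have kT1 := ltnW kT.
by apply: (step_of_field _ kT'); rewrite (subnSK kT1); exact: IHk kT1.
Qed.

(** Forward induction from [x0]: equal states force equal Y and equal [Z *m I], hence equal
    coefficients and increments, and so equal next states. *)
Lemma solves_unique X Y Z :
  (forall t, (t <= T)%N -> node_fun t (X t)) ->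
  (forall t, (t <= T)%N -> node_fun t (Y t)) ->
  (forall t, (t < T)%N -> node_fun t (Z t)) ->
  solves T M x0 b f sigma h X Y Z ->
  [/\ indistinguishable T fwd X, indistinguishable T (fun t w => (bwd t w).1) Y
    & sim_M T M (fun t w => (bwd t w).2) Z].
Proof.
move=> X_node Y_node Z_node sXYZ.
have st := solves_field X_node Y_node Z_node sXYZ.
have [eqX eqY X0 YT] := sXYZ.
have yz t w : (t < T)%N -> fwd t w = X t w ->
    (bwd t w).1 = Y t w /\ (bwd t w).2 *m I = Z t w *m I.
  move=> tT xE; rewrite bwd_lt// xE; have v_ok := fieldS_ok tT.
  exact: one_step_unique tT v_ok (solP w (X t w) tT v_ok) (st t tT w).
have incrM t w (z z' : 'rV[R]_n.+1) : (t < T)%N -> z *m I = z' *m I ->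
    z *m M t.+1 w = z' *m M t.+1 w.
  move=> tT zz'; have [i Wi] := W_basis w tT.
  rewrite (M_successor tT (agree_refl t w) Wi); apply/rowP => j.
  by rewrite (ord1 j) (incr_Itilde (p_gt0 w ^~ tT) (p_sum1 w tT) _ zz').
have fwdX w t : (t <= T)%N -> fwd t w = X t w.
  elim: t => [_|t IHt tT]; first by rewrite X0.
  have xE := IHt (ltnW tT); have [yE zE] := yz t w tT xE.
  rewrite /= -bwd_lt// xE yE zE -[RHS](subrK (X t w)) eqX//.
  by ring.
split=> [w t tT|w t|w t tT]; first exact: fwdX.
- rewrite leq_eqVlt => /predU1P[->|tT].
    by rewrite /bwd ltnn /= YT fwdX.
  by have [] := yz t w tT (fwdX w t (ltnW tT)).
- by apply: incrM => //; have [] := yz t w tT (fwdX w t (ltnW tT)).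
Qed.

End decoupling_field.

(** * Atoms of the filtration as nodes of a finite tree *)

Section transition_tree.
Context {d : measure_display} {Omega : measurableType d} {R : realType}.
Variable P : probability Omega R.
Context {n : nat}.
Variables (T : nat) (W : nat -> Omega -> 'cV[R]_n.+1).

Hypothesis W_basis : basis_valued T W.
Hypothesis F_eq_FT : (measurable : set (set Omega)) = filtration P W T.
Hypothesis W_pos : positive_transitions P T W.

Local Notation F := (filtration P W).
Local Notation G := (generated_by W).
Local Notation atom t w := [set w' | agree W t w w'].

Lemma gen_sigma_algebra t : sigma_algebra setT (G t).
Proof. exact: smallest_sigma_algebra. Qed.

Lemma gen0 t : G t set0.
Proof. by have [] := gen_sigma_algebra t. Qed.

Lemma genS t t' A : (t <= t')%N -> G t A -> G t' A.
Proof.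
move=> tt'; apply: sub_sigma_algebra2 => B [s /= st sB].
by exists s => //=; exact: leq_trans tt'.
Qed.

Lemma gen_filtration t A : G t A -> F t A.
Proof.
move=> GA; exists A, set0; split; rewrite ?measure0//; first exact: gen0.
by move=> x [[]|[]].
Qed.

Lemma filtration_measurable t A : (t <= T)%N -> F t A -> measurable A.
Proof.
move=> tT [B [C [GB GC PC AB]]]; rewrite F_eq_FT.
by exists B, C; split => //; exact: genS tT _.
Qed.

Lemma gen_measurable t A : (t <= T)%N -> G t A -> measurable A.
Proof. by move=> tT /gen_filtration; exact: filtration_measurable. Qed.

(** Unions of nodes form a sigma-algebra that contains the generators. *)
Lemma gen_saturated t A : G t A -> forall w w', agree W t w w' -> A w -> A w'.
Proof.
suff : G t `<=` [set A | forall w w', agree W t w w' -> A w -> A w'].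
  by move=> sub /sub.
apply: smallest_sub => /=.
  split => //= [B BP w w' ww' [_ nBw]|B BP w w' ww' [k _ Bk]].
    by split => // /(BP _ _ (agree_sym ww')).
  by exists k => //; exact: BP Bk.
move=> B [s /= st [i _ [C mC <-]]] w w' ww' [_ Cw]; split => //=.
by rewrite /= -(ww' s st).
Qed.

Lemma gen_value t s (v : 'cV[R]_n.+1) : (s <= t)%N -> G t [set w | W s w = v].
Proof.
move=> st.
have -> : [set w | W s w = v] =
    \bigcap_(i in [set: 'I_n.+1]) [set w | W s w i ord0 = v i ord0].
  apply/seteqP; split=> [w /= Wv i _ /=|w Wv /=]; first by rewrite Wv.
  by apply/matrixP => i j; rewrite (ord1 j); exact: Wv.
apply: (@fin_bigcap_measurable _ (g_sigma_algebraType _) _ _ _ _ _).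
  exact: finite_finset.
move=> i _; apply: sub_sigma_algebra; exists s => //=; exists i => //.
exists [set v i ord0]; first exact: measurable_set1.
by rewrite setTI.
Qed.

Lemma gen_path t (c : {ffun 'I_t.+1 -> 'I_n.+1}) :
  G t [set w | forall s : 'I_t.+1, W s w = delta_mx (c s) ord0].
Proof.
have -> : [set w | forall s : 'I_t.+1, W s w = delta_mx (c s) ord0] =
    \bigcap_(s in [set: 'I_t.+1]) [set w | W s w = delta_mx (c s) ord0].
  by apply/seteqP; split => w Ww s; [move=> _|]; exact: Ww.
apply: (@fin_bigcap_measurable _ (g_sigma_algebraType _) _ _ _ _ _).
  exact: finite_finset.
by move=> s _; apply: gen_value; rewrite -ltnS.
Qed.

Lemma path_of t w : (t <= T)%N ->
  exists c : {ffun 'I_t.+1 -> 'I_n.+1}, forall s : 'I_t.+1, W s w = delta_mx (c s) ord0.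
Proof.
move=> tT; have /choice[c cP] (s : 'I_t.+1) : exists i, W s w = delta_mx i ord0.
  by apply: W_basis; rewrite (leq_trans _ tT)// -ltnS.
by exists [ffun s => c s] => s; rewrite ffunE.
Qed.

(** There are finitely many paths up to time [t], and a union of nodes is a finite union of path
    events. *)
Lemma gen_of_saturated t A : (t <= T)%N ->
  (forall w w', agree W t w w' -> A w -> A w') -> G t A.
Proof.
move=> tT satA.
pose path c := [set w | forall s : 'I_t.+1, W s w = delta_mx (c s) ord0].
have -> : A = \bigcup_(c in [set c : {ffun 'I_t.+1 -> 'I_n.+1} |
    A `&` path c !=set0]) path c.
  apply/seteqP; split => [w Aw|w' [c [w [Aw cw]] cw']].
    by have [c cw] := path_of w tT; exists c => //; exists w.
  apply: satA Aw => s st; rewrite -ltnS in st.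
  by rewrite (cw (Ordinal st)) (cw' (Ordinal st)).
apply: (@fin_bigcup_measurable _ (g_sigma_algebraType _) _ _ _ _ _).
  exact: finite_finset.
by move=> c _; exact: gen_path.
Qed.

Lemma gen_atom t w : (t <= T)%N -> G t (atom t w).
Proof.
by move=> tT; apply: gen_of_saturated => // w1 w2 w12 /= /agree_trans; apply.
Qed.

Lemma node_fun_measurable t (g : Omega -> R) : (t <= T)%N ->
  node_fun W t g -> measurable_wrt (F t) g.
Proof.
move=> tT g_node A [B mB <-]; apply: gen_filtration; apply: (gen_of_saturated tT).
move=> w w' ww' [_ Bw]; by split => //=; rewrite /= -(g_node _ _ ww').
Qed.

(** When every node has positive probability the completion adds nothing: an exceptional null set is
    a union of nodes, hence empty, and level sets are unions of nodes. *)
Lemma measurable_wrt_node_fun t (g : Omega -> R) : (t <= T)%N ->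
  (forall w, P (atom t w) != 0%E) -> measurable_wrt (F t) g -> node_fun W t g.
Proof.
move=> tT P_atom mg w w' ww'.
have [D [C [GD GC PC gDC]]] : F t (setT `&` g @^-1` [set g w]).
  by apply: mg; exists [set g w] => //; exact: measurable_set1.
have C0 x : ~ C x.
  move=> Cx; have /eqP := P_atom x; apply.
  apply: (@subset_measure0 _ _ _ P _ C) => //.
  - by apply: (gen_measurable tT); exact: gen_atom.
  - exact: gen_measurable GC.
  - by move=> y xy; exact: (gen_saturated GC xy Cx).
have gD x : g x = g w <-> D x.
  split => [gx|Dx]; apply: contrapT => nx; apply: (C0 x); apply: gDC.
    by left; split.
  by right; split => // -[].
by apply/esym/gD; apply: (gen_saturated GD ww'); apply/gD.
Qed.

Lemma measurable_wrt_fun t (g : Omega -> R) : (t <= T)%N ->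
  measurable_wrt (F t) g -> measurable_fun setT g.
Proof.
move=> tT mg _ Y mY; apply: (filtration_measurable tT); apply: mg.
by exists Y.
Qed.

(* Setting a version of the conditional expectation to [0] on a null atom would
   give another version, one that is not positive. *)
Lemma atom_neq0 t V w : (t < T)%N -> is_cond_exp_mx P (F t) (W t.+1) V ->
  P (atom t w) != 0%E.
Proof.
move=> tT VP; apply/eqP => P0; have tT' := ltnW tT.
have mN : measurable (atom t w) by apply: (gen_measurable tT'); exact: gen_atom.
pose V' w' : 'cV[R]_n.+1 := if w' \in atom t w then 0 else V w'.
suff /W_pos : is_cond_exp_mx P (F t) (W t.+1) V'.
  move=> /(_ tT w ord0); rewrite /V' ifT ?mxE ?ltxx//.
  by rewrite inE /=; exact: agree_refl.
move=> i j; have [mV iV eV] := VP i j.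
have V'E w' : ~ atom t w w' -> V' w' = V w' by rewrite /V' => nw; rewrite memNset.
have V'0 w' : atom t w w' -> V' w' = 0 by rewrite /V' => nw; rewrite mem_set.
have mV' : measurable_wrt (F t) (fun w' => V' w' i j).
  move=> A [B mB <-].
  have [D [C [GD GC PC VDC]]] : F t (setT `&` (fun w' => V w' i j) @^-1` B).
    by apply: mV; exists B.
  (* The completion absorbs the modification once the null atom joins the exceptional set. *)
  exists D, (C `|` atom t w); split => //.
  - exact: (@measurableU _ (g_sigma_algebraType _) C _ GC (gen_atom w tT')).
  - rewrite measureU0//; exact: gen_measurable GC.
  - move=> x; have [?|nx] := pselect (atom t w x); first by right.
    move=> VDx; left; apply: VDC; move: VDx.
    by rewrite /setY /= V'E.
have mVf : measurable_fun setT (fun w' => V w' i j) by exact: measurable_wrt_fun mV.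
have mVf' : measurable_fun setT (fun w' => V' w' i j).
  exact: measurable_wrt_fun mV'.
split => //.
  apply: le_integrable iV => //; first exact/measurable_EFinP.
  move=> x _ /=; rewrite lee_fin; have [nx|nx] := pselect (atom t w x).
    by rewrite V'0// mxE normr0.
  by rewrite V'E.
move=> A FA; rewrite -eV//.
have mA := filtration_measurable tT' FA.
apply: ae_eq_integral => //.
- by apply/measurable_EFinP; exact: measurable_funTS.
- by apply/measurable_EFinP; exact: measurable_funTS.
exists (atom t w); split => // x /= nx; apply: contrapT => nw; apply: nx => _.
by rewrite V'E.
Qed.

(** * Transition probabilities and conditional covariance at the nodes *)

Hypothesis T_gt0 : (0 < T)%N.
Variable V : nat -> Omega -> 'cV[R]_n.+1.
Hypothesis V_cond_exp : forall t, (t < T)%N ->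
  is_cond_exp_mx P (F t) (W t.+1) (V t).

Local Notation next t i := [set w | W t.+1 w = delta_mx i ord0].

Lemma integral_atom_cst t w (g : Omega -> R) : (t <= T)%N -> node_fun W t g ->
  (\int[P]_(w' in atom t w) (g w')%:E = (g w)%:E * P (atom t w))%E.
Proof.
move=> tT g_node; rewrite -integral_cst; last first.
  by apply: (gen_measurable tT); exact: gen_atom.
by apply: eq_integral => w'; rewrite inE /= => /g_node ->.
Qed.

Lemma V_node_lt t i : (t < T)%N -> node_fun W t (fun w => V t w i ord0).
Proof.
move=> tT; have [mV _ _] := V_cond_exp tT i ord0.
apply: measurable_wrt_node_fun mV; first exact: ltnW.
by move=> w; exact: atom_neq0 tT (V_cond_exp tT).
Qed.

(** [V] is constant on the atom, so the defining property of conditional expectation, tested there,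
    identifies it as a transition probability. *)
Lemma atom_next t w i : (t < T)%N ->
  (P (atom t w `&` next t i) = (V t w i ord0)%:E * P (atom t w))%E.
Proof.
move=> tT; have tT' := ltnW tT; have [_ _ eV] := V_cond_exp tT i ord0.
have GA := gen_atom w tT'.
have := eV _ (gen_filtration GA); rewrite integral_atom_cst//; last exact: V_node_lt.
move=> ->; rewrite setIC -integral_indic; last 2 first.
- exact: (gen_measurable tT').
- by apply: (gen_measurable tT); exact: gen_value.
apply: eq_integral => w' _; rewrite indicE.
have [j Wj] := W_basis w' tT; rewrite Wj mxE eqxx andbT.
have [->|ij] := eqVneq i j; first by rewrite mem_set.
rewrite memNset//= Wj => /matrixP/(_ i ord0); rewrite !mxE !eqxx (negbTE ij)/=.
by move=> /eqP; rewrite eq_sym oner_eq0.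
Qed.

Lemma V_gt0 t w i : (t < T)%N -> 0 < V t w i ord0.
Proof. by move=> tT; exact: (W_pos tT (V_cond_exp tT)). Qed.

(** [atom_neq0] covers only t < T; an atom at time T is a successor of one at T - 1, reached with
    positive probability. *)
Lemma atom_gt0 t w : (t <= T)%N -> exists2 r : R, 0 < r & P (atom t w) = r%:E.
Proof.
move=> tT; have mA : measurable (atom t w).
  by apply: (gen_measurable tT); exact: gen_atom.
exists (fine (P (atom t w))); last by rewrite fineK// fin_num_measure.
rewrite fine_gt0// -ge0_fin_numE// fin_num_measure// lt0e measure_ge0 andbT andbT.
move: tT; rewrite leq_eqVlt => /predU1P[tE|tT]; last first.
  exact: atom_neq0 (V_cond_exp tT).
have [s sT] : exists s, T = s.+1 by exists T.-1; rewrite prednK.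
have sT' : (s < T)%N by rewrite sT.
rewrite tE sT {mA}.
have [i Wi] : exists i, W s.+1 w = delta_mx i ord0 by apply: W_basis; rewrite sT.
have -> : atom s.+1 w = atom s w `&` next s i.
  apply/seteqP; split => [w' ww'|w' [ww' W'i]].
    by split; [exact: agree_le ww'|rewrite /= -ww'].
  by apply: agreeS => //; rewrite Wi W'i.
rewrite atom_next// mule_neq0//; last exact: atom_neq0 (V_cond_exp sT').
by rewrite eqe gt_eqF//; exact: V_gt0.
Qed.

Lemma integral_atom t w (g : Omega -> R) (c : 'I_n.+1 -> R) : (t < T)%N ->
  (forall w' i, agree W t w w' -> W t.+1 w' = delta_mx i ord0 -> g w' = c i) ->
  (\int[P]_(w' in atom t w) (g w')%:E
   = (\sum_i V t w i ord0 * c i)%:E * P (atom t w))%E.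
Proof.
move=> tT gc; have tT' := ltnW tT.
have mA : measurable (atom t w) by apply: (gen_measurable tT'); exact: gen_atom.
have mE i : measurable (next t i).
  by apply: (gen_measurable tT); exact: gen_value.
have iE i : P.-integrable (atom t w) (fun w' => (\1_(next t i) w')%:E : \bar R).
  by apply: (@integrableS _ _ _ _ setT) => //; exact: integrable_indic.
transitivity (\int[P]_(w' in atom t w)
    (\sum_i (c i)%:E * (\1_(next t i) w')%:E))%E.
  apply: eq_integral => w'; rewrite inE /= => ww'.
  have [j Wj] := W_basis w' tT; rewrite (gc w' j)// (bigD1 j)//= big1.
    by rewrite indicE mem_set// mule1 adde0.
  move=> i ij; rewrite indicE memNset ?mule0//= Wj => /matrixP/(_ i ord0).
  rewrite !mxE !eqxx (negbTE ij)/=.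
  by move=> /eqP; rewrite eq_sym oner_eq0.
rewrite integral_sum//; last by move=> i; exact: integrableZl.
have [r _ rE] := atom_gt0 w tT'.
transitivity (\sum_i ((c i)%:E * ((V t w i ord0)%:E * r%:E)))%E.
  apply: eq_bigr => i _; rewrite integralZl// integral_indic//.
  by rewrite setIC -rE; congr (_ * _)%E; exact: atom_next.
rewrite rE -EFinM mulr_suml -sumEFin; apply: eq_bigr => i _.
by rewrite -!EFinM mulrA [c i * _]mulrC.
Qed.

Lemma V_node t : (t < T)%N -> node_fun W t (V t).
Proof.
by move=> tT w w' ww'; apply/matrixP => i j; rewrite (ord1 j) (V_node_lt i tT ww').
Qed.

(** The integral of 1 over an atom, computed in two ways. *)
Lemma V_sum1 t w : (t < T)%N -> \sum_i V t w i ord0 = 1.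
Proof.
move=> tT; have tT' := ltnW tT; have [r r0 rE] := atom_gt0 w tT'.
have := @integral_atom t w (cst 1) (fun=> 1) tT (fun _ _ _ _ => erefl).
rewrite (@integral_atom_cst t w (cst 1))// rE -!EFinM => -[].
move=> /(mulIf (lt0r_neq0 r0)) ->.
by apply: eq_bigr => i _; rewrite mulr1.
Qed.

(** An event of positive probability is nonempty. *)
Lemma next_exists t w (i : 'I_n.+1) : (t < T)%N ->
  exists2 w', agree W t w w' & W t.+1 w' = delta_mx i ord0.
Proof.
move=> tT; have [r r0 rE] := atom_gt0 w (ltnW tT).
have : P (atom t w `&` next t i) != 0%E.
  rewrite atom_next// rE -EFinM eqe gt_eqF// mulr_gt0//; exact: V_gt0.
apply: contra_neqP => ne; rewrite (_ : _ `&` _ = set0) ?measure0//.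
by apply/seteqP; split => // w' [ww' Wi]; apply: ne; exists w'.
Qed.

(** Testing [Q t] on an atom gives the sum over k of p_k (1_(i=k) - p_i)(1_(j=k) - p_j), the
    covariance of a random basis vector with law p. *)
Lemma cond_cov_node (M : nat -> Omega -> 'cV[R]_n.+1)
    (Q : nat -> Omega -> 'M[R]_n.+1) t w i j : (t < T)%N ->
  (forall w', M t.+1 w' = W t.+1 w' - V t w') ->
  is_cond_cov P T W M Q ->
  Q t w i j = V t w i ord0 * ((i == j)%:R - V t w j ord0).
Proof.
move=> tT ME Q_cov; have tT' := ltnW tT; have [mQ _ eQ] := Q_cov t tT i j.
have [r r0 rE] := atom_gt0 w tT'.
have Q_node : node_fun W t (fun w => Q t w i j).
  by apply: measurable_wrt_node_fun mQ => // w'; exact: atom_neq0 (V_cond_exp tT).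
have := eQ _ (gen_filtration (gen_atom w tT')); rewrite integral_atom_cst//.
rewrite (@integral_atom t w _ (fun k => ((i == k)%:R - V t w i ord0) *
   ((j == k)%:R - V t w j ord0)))//; last first.
  move=> w' k ww' Wk; rewrite mxE big_ord1 !mxE ME Wk (V_node tT ww').
  by rewrite !mxE !andbT.
rewrite rE -!EFinM => -[] /(mulIf (lt0r_neq0 r0)) ->.
have V1 := V_sum1 w tT.
transitivity (\sum_k ((i == k)%:R * ((j == k)%:R * V t w k ord0)
   - V t w j ord0 * ((i == k)%:R * V t w k ord0)
   - V t w i ord0 * ((j == k)%:R * V t w k ord0)
   + V t w i ord0 * V t w j ord0 * V t w k ord0)).
  by apply: eq_bigr => k _; ring.
have delta a (c : 'I_n.+1 -> R) : \sum_k (a == k)%:R * c k = c a.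
  rewrite (bigD1 a)//= eqxx mul1r big1 ?addr0// => k.
  by rewrite eq_sym => /negbTE ->; rewrite mul0r.
rewrite big_split/= !sumrB -!mulr_sumr V1 !delta.
by have [->|] := eqVneq i j; rewrite ?eqxx /=; [|move=> _]; ring.
Qed.

End transition_tree.

(** * Existence and uniqueness, transferred from the tree to adapted processes *)

Theorem theorem4p2 (R : realType) (d : measure_display)
    (Omega : measurableType d) (P : probability Omega R) (n T : nat)
    (W M : nat -> Omega -> 'cV[R]_n.+1) (Q : nat -> Omega -> 'M[R]_n.+1)
    (x0 : R)
    (b f : Omega -> nat -> R -> R -> 'rV[R]_n -> R)
    (sigma : Omega -> nat -> R -> R -> 'rV[R]_n -> 'rV[R]_n.+1)
    (h : Omega -> R -> R) (c1 c2 : R)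
    (T_gt0 : (0 < T)%N)
    (W_basis : basis_valued T W)
    (F_eq_FT : (measurable : set (set Omega)) = filtration P W T)
    (W_pos : positive_transitions P T W)
    (M_def : is_mart_diff P T W M)
    (Q_def : is_cond_cov P T W M Q)
    (coef_adapted : adapted_coefficients P T W b f sigma h)
    (coef_continuous : continuous_coefficients T b f sigma h)
    (c1_gt0 : 0 < c1) (c2_gt0 : 0 < c2)
    (coef_lipschitz : lipschitz_condition T Q b f sigma h c1)
    (coef_monotone : monotone_condition T Q b f sigma h c2) :
  exists (X Y : nat -> Omega -> R) (Z : nat -> Omega -> 'rV[R]_n.+1),
    adapted_solution P T W M x0 b f sigma h X Y Z /\
    forall (X' Y' : nat -> Omega -> R) (Z' : nat -> Omega -> 'rV[R]_n.+1),
      adapted_solution P T W M x0 b f sigma h X' Y' Z' ->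
      [/\ indistinguishable T X X', indistinguishable T Y Y'
        & sim_M T M Z Z'].
Proof.
(* The version of the conditional expectation that defines [M] is fixed at each time; the zero from
   the horizon on is a filler. *)
have /choice[V VP] t : exists V, (t < T)%N ->
    is_cond_exp_mx P (filtration P W t) (W t.+1) V /\
    forall w, M t.+1 w = W t.+1 w - V w.
  have [tT|_] := ltnP t T; last by exists (fun=> 0).
  by have [V VP ME] := M_def t tT; exists V.
have V_ce t (tT : (t < T)%N) := (VP t tT).1.
have ME t w (tT : (t < T)%N) := (VP t tT).2 w.
(* With all atoms of positive probability, up to time T included, adaptedness and dependence on the
   node become interchangeable. *)
have wrt_node t (g : Omega -> R) : (t <= T)%N -> measurable_wrt (filtration P W t) g ->
    node_fun W t g.
  move=> tT mg.
  have P_atom w : P [set w' | agree W t w w'] != 0%E.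
    have [r r0 ->] := atom_gt0 W_basis F_eq_FT W_pos T_gt0 V_ce w tT.
    by rewrite eqe gt_eqF.
  exact: (measurable_wrt_node_fun W_basis F_eq_FT tT P_atom mg).
have wrt_node_mx t m q (g : Omega -> 'M[R]_(m, q)) : (t <= T)%N ->
    mx_measurable_wrt (filtration P W t) g -> node_fun W t g.
  move=> tT mg w w' ww'; apply/matrixP => i j.
  exact: (wrt_node t (fun w => g w i j) tT (mg i j) w w' ww').
have node_wrt t (g : Omega -> R) : (t <= T)%N -> node_fun W t g ->
    measurable_wrt (filtration P W t) g.
  exact: (node_fun_measurable P W_basis).
have p_gt0 t w i := V_gt0 W_pos V_ce w i (t := t).
have p_sum1 t w := V_sum1 W_basis F_eq_FT W_pos T_gt0 V_ce w (t := t).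
have p_node := V_node W_basis F_eq_FT W_pos V_ce.
have succ t w i := next_exists W_basis F_eq_FT W_pos T_gt0 V_ce w i (t := t).
have QE t w i j (tT : (t < T)%N) :=
  cond_cov_node W_basis F_eq_FT W_pos T_gt0 V_ce w i j tT (ME t ^~ tT) Q_def.
have [mb msigma mf mh] := coef_adapted.
have b_node t : (t < T)%N -> node_fun W t (b ^~ t).
  move=> tT w w' ww'; apply/funext => x; apply/funext => y; apply/funext => z.
  exact: (wrt_node t _ (ltnW tT) (mb t x y z tT) w w' ww').
have sigma_node t : (t < T)%N -> node_fun W t (sigma ^~ t).
  move=> tT w w' ww'; apply/funext => x; apply/funext => y; apply/funext => z.
  exact: (wrt_node_mx t _ _ _ (ltnW tT) (msigma t x y z tT) w w' ww').
have f_node t : (0 < t <= T)%N -> node_fun W t (f ^~ t).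
  move=> tT w w' ww'; apply/funext => x; apply/funext => y; apply/funext => z.
  by apply: (wrt_node t (fun w => f w t x y z)) => //; [case/andP: tT|exact: mf].
have h_node : node_fun W T h.
  move=> w w' ww'; apply/funext => x.
  exact: (wrt_node T _ (leqnn T) (mh x) w w' ww').
pose X := fwd T W M x0 b f sigma h.
pose YZ := bwd T W M x0 b f sigma h.
have X_node : forall t, (t <= T)%N -> node_fun W t (X t).
  exact: (fwd_node _ _ _ p_node ME b_node sigma_node).
have YZ_node : forall t, (t <= T)%N -> node_fun W t (YZ t).
  exact: (bwd_node _ _ p_node ME b_node sigma_node h_node).
have lt_pred t : (t <= T.-1)%N = (t < T)%N by rewrite -ltnS prednK.
exists X, (fun t w => (YZ t w).1), (fun t w => (YZ t w).2); split.
  split.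
  - by move=> t tT; apply: node_wrt => //; exact: X_node.
  - move=> t tT; apply: node_wrt => // w w' ww'.
    by rewrite (YZ_node t tT _ _ ww').
  - move=> t; rewrite lt_pred => tT i j; apply: (node_wrt t _ (ltnW tT)) => w w' ww'.
    by rewrite (YZ_node t (ltnW tT) _ _ ww').
  - exact: (fwd_bwd_solves x0 W_basis p_gt0 p_sum1 p_node ME succ QE b_node sigma_node
      f_node h_node T_gt0 c1_gt0 c2_gt0 coef_lipschitz coef_monotone).
move=> X' Y' Z' [aX' aY' aZ' sol'].
apply: (solves_unique W_basis p_gt0 p_sum1 p_node ME succ QE b_node sigma_node
      f_node h_node T_gt0 c1_gt0 c2_gt0 coef_lipschitz coef_monotone) => // t tT.
- exact: (wrt_node t _ tT (aX' t tT)).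
- exact: (wrt_node t _ tT (aY' t tT)).
- by apply: (wrt_node_mx t _ _ _ (ltnW tT)); apply: aZ'; rewrite lt_pred.
Qed.
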